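(* Consider the convex integration realizations generated by an admissible piecewise constant fan subsolution (''the fan'') and a piecewise constant self-similar reference solution with the same Riemann data, with kinetic and internal energy mismatches $\mathfrak K$, $\mathfrak I$. Then: (i) The action and entropy rate criteria both strictly prefer the fan to the reference solution if and only if $\mathfrak K>0$ and $|\mathfrak I|<\frac{\mathfrak K}{2}$. (ii) Both criteria strictly prefer the reference solution if and only if $\mathfrak K<0$ and $|\mathfrak I|<\frac{|\mathfrak K|}{2}$. (iii) The action rate criterion strictly prefers the fan while the entropy rate criterion strictly prefers the reference solution if and only if $\mathfrak I>\frac{|\mathfrak K|}{2}$. (iv) The action rate criterion strictly prefers the reference solution while the entropy rate criterion strictly prefers the fan if and only if $\mathfrak I<-\frac{|\mathfrak K|}{2}$.
   Context: Pressure law: $p$ is a sufficiently smooth function on $(0,\infty)$ with $p'>0$, and the specific internal energy $e$ satisfies $p(\rho)=\rho^2e'(\rho)$. Isentropic Euler equations in two space dimensions: $\partial_t\rho+\mathrm{div}(\rho v)=0$, $\partial_t(\rho v)+\mathrm{div}(\rho v\otimes v)+\nabla p(\rho)=0$. Energy and Lagrangian densities: $H(\rho,v)=\tfrac12\rho|v|^2+\rho e(\rho)$, $\mathcal L(\rho,v)=\tfrac12\rho|v|^2-\rho e(\rho)$. A bounded entropic weak solution is a pair $(\rho,v)\in L^\infty$ with $\rho>0$ a.e. that solves the Euler equations in the sense of distributions and satisfies $\partial_tH+\mathrm{div}((H+p(\rho))v)\le0$ in the sense of distributions. Riemann data: $(\rho_-,v_-)$ for $x_2<0$ and $(\rho_+,v_+)$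 for $x_2>0$. Admissible piecewise constant fan subsolution: constants $\rho_i>0$, $v_i\in\mathbb R^2$, $u_i$ a trace-free symmetric $2\times2$ real matrix, $C_i>0$ ($i=1,\dots,N$), and speeds $\nu_0<\nu_1<\dots<\nu_N$. Put $P_-=\{t>0,\,x_2<\nu_0t\}$, $P_i=\{t>0,\,\nu_{i-1}t<x_2<\nu_it\}$, $P_+=\{t>0,\,x_2>\nu_Nt\}$, and let $\bar\rho,\bar v,\bar u,\bar C$ be the piecewise constant fields with values $\rho_i,v_i,u_i,C_i$ in $P_i$ and $\rho_\pm,\ v_\pm,\ v_\pm\otimes v_\pm-\tfrac12|v_\pm|^2\mathrm{Id},\ |v_\pm|^2$ in $P_\pm$. One requires $v_i\otimes v_i-u_i<\tfrac{C_i}{2}\mathrm{Id}$ for all $i$; the relaxed equations $\partial_t\bar\rho+\mathrm{div}(\bar\rho\bar v)=0$, $\partial_t(\bar\rho\bar v)+\mathrm{div}(\bar\rho\bar u)+\nabla(p(\bar\rho)+\tfrac12\bar\rho\bar C)=0$ (equivalently, the Rankine–Hugoniot relations at every interface); and the admissibility inequality $\partial_t\bar H+\mathrm{div}((\bar H+p(\bar\rho))\bar v)\le0$ with $\bar H=\tfrac12\bar\rho\bar C+\bar\rho e(\bar\rho)$. A convex integration realization generated by the fan is a bounded entropic weak solution $(\rho,v)$ with the same Riemann data such that $\rho=\bar\rho$ a.e., $v=v_\pm$ in $P_\pm$, and $|v|^2=C_i$ a.e. in $P_i$. Reference solution: a partition $-\infty=\sigma_0<\sigma_1<\dots<\sigma_M=\infty$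 and constants $(\rho_j^{\mathrm{ref}},v_j^{\mathrm{ref}})$, with $(\rho^{\mathrm{ref}},v^{\mathrm{ref}})(x,t)=(\rho^{\mathrm{ref}}_j,v^{\mathrm{ref}}_j)$ whenever $\sigma_{j-1}<x_2/t<\sigma_j$; $C_j^{\mathrm{ref}}:=|v_j^{\mathrm{ref}}|^2$. Standing assumption: the fan and reference profiles agree on $P_-$ and $P_+$. Mismatches: with $\omega_{ij}=\max\{0,\min\{\nu_i,\sigma_j\}-\max\{\nu_{i-1},\sigma_{j-1}\}\}$, $\mathfrak K=\sum_{i,j}\omega_{ij}(\rho_j^{\mathrm{ref}}C_j^{\mathrm{ref}}-\rho_iC_i)$ and $\mathfrak I=\sum_{i,j}\omega_{ij}[\rho_ie(\rho_i)-\rho_j^{\mathrm{ref}}e(\rho_j^{\mathrm{ref}})]$. Criteria: on the strip $\Omega_\ell=(\mathbb R/\ell\mathbb Z)\times\mathbb R$, $\ell>0$, for two solutions with the same Riemann data put $\Delta\mathcal E(t)=\int_{\Omega_\ell}[H(\rho^{(1)},v^{(1)})-H(\rho^{(2)},v^{(2)})]\,dx$ and $\Delta\mathcal A(t)=\int_0^t\int_{\Omega_\ell}[\mathcal L(\rho^{(1)},v^{(1)})-\mathcal L(\rho^{(2)},v^{(2)})]\,dx\,d\tau$. Solution $(1)$ is strictly preferred to $(2)$ by the entropy rate criterion if $\frac{d}{dt}\big|_{t^+}\Delta\mathcal E<0$, and by the action rate criterion if there is $t_1>0$ such that $\Delta\mathcal A(t)\le0$ for all $t\in(0,t_1)$ with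 strict inequality for some $t\in(0,t_1)$. For fixed-time statements, the almost-everywhere identities of a realization are understood to hold for a.e. $x$ at the time considered. *)

(* Defs.v *)
From mathcomp Require Import all_boot all_order all_algebra.
From mathcomp Require Import all_classical all_reals all_analysis.

Set Implicit Arguments.
Unset Strict Implicit.
Unset Printing Implicit Defensive.

Import Order.TTheory GRing.Theory Num.Theory numFieldNormedType.Exports.

Local Open Scope classical_set_scope.
Local Open Scope ring_scope.

(* A point of space-time is z = (x, t) with x = (x1, x2), so that
   z.1.2 is x2 and z.2 is t. *)
Notation plane R := (R * R)%type.
Notation spacetime R := (R * R * R)%type.

Section Defs.
Context {R : realType}.

Definition leb2 := (@lebesgue_measure R \x @lebesgue_measure R)%E.
Definition leb3 := (leb2 \x @lebesgue_measure R)%E.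

Definition future : set (spacetime R) := [set z | 0 < z.2].

Definition normsq (v : 'cV[R]_2) : R := \sum_(k < 2) v k 0 ^+ 2.

Definition posdef (M : 'M[R]_2) : Prop :=
  forall x : 'cV[R]_2, x != 0 -> 0 < (x^T *m M *m x) 0 0.

(* "Sufficiently smooth" is read as C^1. *)
Definition pressure_law (p e : R -> R) : Prop := forall r : R, 0 < r ->
  [/\ derivable p r 1, {for r, continuous (derive1 p)}, 0 < derive1 p r,
      derivable e r 1 & p r = r ^+ 2 * derive1 e r].

Definition energy (e : R -> R) (r : R) (w : 'cV[R]_2) : R :=
  r * normsq w / 2 + r * e r.

Definition lagrangian (e : R -> R) (r : R) (w : 'cV[R]_2) : R :=
  r * normsq w / 2 - r * e r.

Definition dir_t : spacetime R := (0, 0, 1).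
Definition dir_x (k : 'I_2) : spacetime R :=
  ((k == 0 :> nat)%:R, (k == 1%N :> nat)%:R, 0).

Fixpoint iter_derive (s : seq (spacetime R)) (phi : spacetime R -> R) :
    spacetime R -> R :=
  if s is w :: s' then (fun z => 'D_w (iter_derive s' phi) z) else phi.

Definition smooth (phi : spacetime R -> R) : Prop :=
  forall s, continuous (iter_derive s phi) /\
    forall z w, derivable (iter_derive s phi) z w.

Definition test_function (D : set (spacetime R)) (phi : spacetime R -> R) :=
  let supp := closure [set z | phi z != 0] in
  [/\ smooth phi, compact supp & supp `<=` D].

(* With D = future this is L^1_loc of the open half space; with D = setT it is
   local integrability up to t = 0. *)
Definition loc_integrable (D : set (spacetime R)) (f : spacetime R -> R) :=
  forall K : set (spacetime R), compact K -> K `<=` D ->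
    leb3.-integrable (K `&` future) (EFin \o f).

Definition pairing (q : spacetime R -> R) (f : 'I_2 -> spacetime R -> R)
    (phi : spacetime R -> R) : R :=
  \int[leb3]_(z in future)
    (q z * 'D_dir_t phi z + \sum_(k < 2) f k z * 'D_(dir_x k) phi z).

(* d_t q + div f = 0 in the sense of distributions on t > 0 *)
Definition balance_eq (q : spacetime R -> R) (f : 'I_2 -> spacetime R -> R) :=
  [/\ loc_integrable future q, forall k, loc_integrable future (f k) &
      forall phi, test_function future phi -> pairing q f phi = 0].

(* d_t q + div f <= 0 in the sense of distributions on t > 0 *)
Definition balance_le (q : spacetime R -> R) (f : 'I_2 -> spacetime R -> R) :=
  [/\ loc_integrable future q, forall k, loc_integrable future (f k) &
      forall phi, test_function future phi -> (forall z, 0 <= phi z) ->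
        0 <= pairing q f phi].

(* d_t q + div f = 0 on t > 0 with initial datum q0: the test functions need
   not vanish near t = 0. *)
Definition cauchy_eq (q0 : plane R -> R) (q : spacetime R -> R)
    (f : 'I_2 -> spacetime R -> R) :=
  [/\ loc_integrable setT q, forall k, loc_integrable setT (f k) &
      forall phi, test_function setT phi ->
        pairing q f phi + \int[leb2]_x (q0 x * phi (x, 0)) = 0].

Record flow := Flow {
  rho : spacetime R -> R;
  vel : spacetime R -> 'cV[R]_2
}.

Record riemann_data := RiemannData {
  rho_minus : R;
  v_minus : 'cV[R]_2;
  rho_plus : R;
  v_plus : 'cV[R]_2
}.

Definition rho_init (d : riemann_data) (x : plane R) : R :=
  if x.2 < 0 then rho_minus d else rho_plus d.

Definition v_init (d : riemann_data) (x : plane R) : 'cV[R]_2 :=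
  if x.2 < 0 then v_minus d else v_plus d.

Record bounded_weak_solution (p : R -> R) (d : riemann_data) (U : flow) :
    Prop := {
  sol_measurable_rho : measurable_fun future (rho U);
  sol_measurable_v : forall k, measurable_fun future (fun z => vel U z k 0);
  sol_bounded : exists B : R, {ae leb3, forall z, 0 < z.2 ->
    `|rho U z| <= B /\ forall k, `|vel U z k 0| <= B};
  sol_positive : {ae leb3, forall z, 0 < z.2 -> 0 < rho U z};
  sol_mass : cauchy_eq (rho_init d) (rho U)
    (fun j z => rho U z * vel U z j 0);
  sol_momentum : forall k : 'I_2,
    cauchy_eq (fun x => rho_init d x * v_init d x k 0)
      (fun z => rho U z * vel U z k 0)
      (fun j z => rho U z * vel U z k 0 * vel U z j 0
                  + (k == j)%:R * p (rho U z))
}.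

Definition entropy_inequality (p e : R -> R) (U : flow) : Prop :=
  balance_le (fun z => energy e (rho U z) (vel U z))
    (fun j z => (energy e (rho U z) (vel U z) + p (rho U z)) * vel U z j 0).

Definition bounded_entropic_weak_solution (p e : R -> R) (d : riemann_data)
    (U : flow) : Prop :=
  bounded_weak_solution p d U /\ entropy_inequality p e U.

(* The weak formulation does not see the slice t = 0 of a representative, so it
   is fixed separately. *)
Definition starts_from (d : riemann_data) (U : flow) : Prop :=
  {ae leb2, forall x, rho U (x, 0) = rho_init d x /\
                      vel U (x, 0) = v_init d x}.

(* The sector with index i : 'I_N (zero-based) is bounded by the speeds
   nu (sector_lo i) and nu (sector_hi i). *)
Definition sector_lo (N : nat) (i : 'I_N) : 'I_N.+1 := widen_ord (leqnSn N) i.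
Definition sector_hi (N : nat) (i : 'I_N) : 'I_N.+1 := lift ord0 i.

Record fan := Fan {
  fan_size : nat;
  nu : 'I_fan_size.+1 -> R;
  fan_rho : 'I_fan_size -> R;
  fan_v : 'I_fan_size -> 'cV[R]_2;
  fan_u : 'I_fan_size -> 'M[R]_2;
  fan_C : 'I_fan_size -> R
}.
Arguments nu : clear implicits.

Definition in_left (F : fan) (z : spacetime R) : bool :=
  z.1.2 < nu F ord0 * z.2.
Definition in_right (F : fan) (z : spacetime R) : bool :=
  nu F ord_max * z.2 < z.1.2.
Definition in_sector (F : fan) (i : 'I_(fan_size F)) (z : spacetime R) : bool :=
  (nu F (sector_lo i) * z.2 < z.1.2) && (z.1.2 < nu F (sector_hi i) * z.2).

(* Piecewise constant field with value l in P_-, w i in P_i and r in P_+; the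
   value r taken on the interfaces, which form a null set, is immaterial. *)
Definition fan_field (F : fan) (T : Type) (l : T) (w : 'I_(fan_size F) -> T)
    (r : T) (z : spacetime R) : T :=
  if in_left F z then l
  else if [pick i | in_sector i z] is Some i then w i else r.

Definition rho_bar (d : riemann_data) (F : fan) :=
  fan_field (rho_minus d) (@fan_rho F) (rho_plus d).
Definition v_bar (d : riemann_data) (F : fan) :=
  fan_field (v_minus d) (@fan_v F) (v_plus d).
Definition C_bar (d : riemann_data) (F : fan) :=
  fan_field (normsq (v_minus d)) (@fan_C F) (normsq (v_plus d)).

Definition traceless_square (w : 'cV[R]_2) : 'M[R]_2 :=
  w *m w^T - (normsq w / 2)%:M.
Definition u_bar (d : riemann_data) (F : fan) :=
  fan_field (traceless_square (v_minus d)) (@fan_u F)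
            (traceless_square (v_plus d)).

Definition H_bar (e : R -> R) (d : riemann_data) (F : fan) (z : spacetime R) :=
  rho_bar d F z * C_bar d F z / 2 + rho_bar d F z * e (rho_bar d F z).

Record admissible_fan (p e : R -> R) (d : riemann_data) (F : fan) : Prop := {
  fan_nonempty : (0 < fan_size F)%N;
  fan_nu_incr : forall i j : 'I_(fan_size F).+1, (i < j)%N -> nu F i < nu F j;
  fan_rho_gt0 : forall i, 0 < @fan_rho F i;
  fan_C_gt0 : forall i, 0 < @fan_C F i;
  fan_u_sym : forall i, (@fan_u F i)^T = @fan_u F i;
  fan_u_tr0 : forall i, \tr (@fan_u F i) = 0;
  fan_subsolution : forall i, posdef
    ((@fan_C F i / 2)%:M - (@fan_v F i *m (@fan_v F i)^T - @fan_u F i));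
  fan_mass : balance_eq (rho_bar d F)
    (fun j z => rho_bar d F z * v_bar d F z j 0);
  fan_momentum : forall k : 'I_2,
    balance_eq (fun z => rho_bar d F z * v_bar d F z k 0)
      (fun j z => rho_bar d F z * u_bar d F z k j
         + (k == j)%:R * (p (rho_bar d F z)
                          + rho_bar d F z * C_bar d F z / 2));
  fan_energy : balance_le (H_bar e d F)
    (fun j z => (H_bar e d F z + p (rho_bar d F z)) * v_bar d F z j 0)
}.

Definition realizes_at (d : riemann_data) (F : fan) (U : flow)
    (z : spacetime R) : Prop :=
  [/\ rho U z = rho_bar d F z,
      in_left F z -> vel U z = v_minus d,
      in_right F z -> vel U z = v_plus d &
      forall i : 'I_(fan_size F), in_sector i z ->
        normsq (vel U z) = @fan_C F i].

Definition realization (p e : R -> R) (d : riemann_data) (F : fan) (U : flow) :=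
  bounded_entropic_weak_solution p e d U /\
  {ae leb3, forall z, 0 < z.2 -> realizes_at d F U z}.

(* The representative of U is chosen so that the identities also hold at every
   positive time, for almost every x. *)
Definition realizes_timewise (d : riemann_data) (F : fan) (U : flow) : Prop :=
  forall t, 0 < t -> {ae leb2, forall x, realizes_at d F U (x, t)}.

Record reference := Reference {
  ref_size : nat;
  sigma : 'I_ref_size.+1 -> \bar R;
  ref_rho : 'I_ref_size -> R;
  ref_v : 'I_ref_size -> 'cV[R]_2
}.
Arguments sigma : clear implicits.

Definition ref_C (G : reference) (j : 'I_(ref_size G)) : R :=
  normsq (ref_v j).

Definition ref_partition (G : reference) : Prop :=
  [/\ sigma G ord0 = -oo%E, sigma G ord_max = +oo%E &
      forall i j : 'I_(ref_size G).+1, (i < j)%N -> (sigma G i < sigma G j)%E].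

Definition in_ref_sector (G : reference) (j : 'I_(ref_size G))
    (z : spacetime R) : bool :=
  ((sigma G (sector_lo j) < (z.1.2 / z.2)%:E)%E &&
   ((z.1.2 / z.2)%:E < sigma G (sector_hi j))%E).

(* Nothing is said on the rays x2 = sigma_j t, which form a null set. *)
Definition has_profile (G : reference) (V : flow) : Prop :=
  forall z (j : 'I_(ref_size G)), 0 < z.2 -> in_ref_sector j z ->
    rho V z = ref_rho j /\ vel V z = ref_v j.

Definition reference_solution (p : R -> R) (d : riemann_data) (G : reference)
    (V : flow) : Prop :=
  [/\ ref_partition G, has_profile G V & bounded_weak_solution p d V].

Definition agree_outside_fan (d : riemann_data) (F : fan) (G : reference) :=
  forall z (j : 'I_(ref_size G)), 0 < z.2 -> in_ref_sector j z ->
    (in_left F z -> ref_rho j = rho_minus d /\ ref_v j = v_minus d) /\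
    (in_right F z -> ref_rho j = rho_plus d /\ ref_v j = v_plus d).

(* The endpoints are extended reals, but the minimum and the maximum below are
   finite whenever sigma is strictly increasing, so that fine loses nothing. *)
Definition overlap (F : fan) (G : reference)
    (i : 'I_(fan_size F)) (j : 'I_(ref_size G)) : R :=
  Num.max 0 (fine (mine (nu F (sector_hi i))%:E (sigma G (sector_hi j)))
           - fine (maxe (nu F (sector_lo i))%:E (sigma G (sector_lo j)))).

Definition kinetic_mismatch (F : fan) (G : reference) : R :=
  \sum_(i < fan_size F) \sum_(j < ref_size G)
    overlap i j * (ref_rho j * ref_C j - fan_rho i * fan_C i).

Definition internal_mismatch (e : R -> R) (F : fan) (G : reference) : R :=
  \sum_(i < fan_size F) \sum_(j < ref_size G)
    overlap i j * (fan_rho i * e (fan_rho i) - ref_rho j * e (ref_rho j)).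

(* A fundamental domain of (R / lZ) x R. Functions on the quotient are the
   l-periodic ones, and their integral is the integral over this set. *)
Definition strip (l : R) : set (plane R) := [set x | 0 <= x.1 < l].

Definition Delta_E (e : R -> R) (l : R) (U1 U2 : flow) (t : R) : R :=
  \int[leb2]_(x in strip l)
    (energy e (rho U1 (x, t)) (vel U1 (x, t))
     - energy e (rho U2 (x, t)) (vel U2 (x, t))).

Definition Delta_A (e : R -> R) (l : R) (U1 U2 : flow) (t : R) : R :=
  \int[@lebesgue_measure R]_(tau in `[0, t]) \int[leb2]_(x in strip l)
    (lagrangian e (rho U1 (x, tau)) (vel U1 (x, tau))
     - lagrangian e (rho U2 (x, tau)) (vel U2 (x, tau))).

Definition entropy_rate_prefers (e : R -> R) (l : R) (t : R) (U1 U2 : flow) :=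
  exists2 dE : R,
    h^-1 * (Delta_E e l U1 U2 (t + h) - Delta_E e l U1 U2 t) @[h --> 0^'+]
      --> dE
    & dE < 0.

Definition action_rate_prefers (e : R -> R) (l : R) (U1 U2 : flow) :=
  exists2 t1 : R, 0 < t1 &
    (forall t, 0 < t < t1 -> Delta_A e l U1 U2 t <= 0) /\
    (exists2 t, 0 < t < t1 & Delta_A e l U1 U2 t < 0).

End Defs.

Arguments flow R : clear implicits.
Arguments riemann_data R : clear implicits.
Arguments fan R : clear implicits.
Arguments reference R : clear implicits.

(* Main.v *)
From HB Require Import structures.
Require Import Defs.
From mathcomp Require Import all_boot all_order all_algebra.
From mathcomp Require Import all_classical all_reals all_analysis.
From mathcomp Require Import ring lra.

(** Only two scalar numbers decide both criteria, because everything in sight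
is self-similar.  The energy and Lagrangian densities see a state only through
its mass density and its squared speed, so for a realization at a positive
time they are almost everywhere constant on each sector of the fan; for the
reference solution they are constant on each of its own sectors, and outside
the fan the two profiles agree.  Hence the difference of the two densities is a step function of
[x2 / t] supported in the common refinement of both partitions, and its
integral over the strip is [l * t] times the sum of the jumps weighted by the
overlaps of the sectors ([slice_integral]).  Both solutions start from the
same data, so the formula holds at [t = 0] too.

For the energy the weighted sum is [I - K / 2], for the Lagrangian it is
[- (I + K / 2)] ([sum_overlap_energy], [sum_overlap_lagrangian]).  The energy
gap is therefore linear in [t], with the same slope at every time
([entropy_rate_prefers_linear]), and the action gap is quadratic in [t]
([action_rate_prefers_quadratic]).  The fan is preferred by the entropy
criterion iff [I < K / 2] and by the action criterion iff [- (K / 2) < I],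
with the opposite strict inequalities for the reference solution; the four
assertions are the four ways of combining these.

One measure-theoretic point needs care: the internal energy is unconstrained
at nonpositive densities, which a realization may take on a null set, and the
product of Lebesgue measures on Borel sets is not complete.  The integrands
need not be measurable, so the integral is shown to ignore null sets for
arbitrary functions ([ae_integral_congr]). *)

Set Implicit Arguments.
Unset Strict Implicit.
Unset Printing Implicit Defensive.

Import Order.TTheory GRing.Theory Num.Theory numFieldNormedType.Exports.

Local Open Scope classical_set_scope.
Local Open Scope ring_scope.

(** * Null sets and integrals of arbitrary functions *)

Section NullSet.
Context d (T : measurableType d) (R : realType).
Context (mu : {measure set T -> \bar R}).
Import HBNNSimple.

Local Open Scope ereal_scope.

(** The integral of a nonnegative function is a supremum over the simple
functions below it; restricting such a simple function to the complement of a
null set keeps its integral, and the restriction lies below the restricted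
function. *)
Lemma ge0_integral_setD_null (D N : set T) (f : T -> \bar R) :
  measurable N -> mu N = 0 -> (forall x, 0 <= f x) ->
  \int[mu]_(x in D) f x = \int[mu]_(x in D `\` N) f x.
Proof.
move=> mN N0 f0; rewrite !ge0_integralE//.
apply/eqP; rewrite eq_le; apply/andP; split; apply/ge_ereal_sup => _ [h /= hf <-].
  have mNC : measurable (~` N) by exact: measurableC.
  apply: ereal_sup_ubound => /=; exists (proj_nnsfun h mNC).
    move=> x; rewrite -mrestrict !patchE.
    have [xN|xN] := pselect (N x).
      by rewrite !memNset//= => -[].
    rewrite mem_set//=; have := hf x; rewrite patchE.
    have [xD|xD] := pselect (D x).
      by rewrite (mem_set xD) (@mem_set _ (D `\` N)).
    by rewrite (memNset xD) memNset// => -[].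
  rewrite -mrestrict -integral_nnsfun// -integralT_nnsfun.
  rewrite [RHS](ge0_negligible_integral mN)//.
  - by rewrite setTD.
  - exact/measurable_realfun.measurable_EFinP.
  - by move=> x _; rewrite lee_fin.
apply: ereal_sup_ubound => /=; exists h => // x; apply: (le_trans (hf x)).
rewrite !patchE; case: ifPn => xDN; last by case: ifP.
by rewrite ifT//; move: xDN; rewrite !inE => -[].
Qed.

Lemma integral_setD_null (D N : set T) (f : T -> \bar R) :
  measurable N -> mu N = 0 ->
  \int[mu]_(x in D) f x = \int[mu]_(x in D `\` N) f x.
Proof.
move=> mN N0; rewrite integralE [RHS]integralE.
by congr (_ - _); exact: ge0_integral_setD_null.
Qed.

Lemma ae_integral_congr (D : set T) (f g : T -> \bar R) :
  ae_eq mu D f g -> \int[mu]_(x in D) f x = \int[mu]_(x in D) g x.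
Proof.
move=> [N [mN N0 fgN]].
rewrite (integral_setD_null _ _ mN N0) [RHS](integral_setD_null _ _ mN N0).
apply: eq_integral => x; rewrite inE => -[Dx Nx].
by apply: contra_notP Nx => fg; apply: fgN => /= /(_ Dx).
Qed.

Lemma ae_Rintegral_congr (D : set T) (f g : T -> R) :
  ae_eq mu D f g ->
  (\int[mu]_(x in D) f x = \int[mu]_(x in D) g x)%R.
Proof.
move=> fg; congr fine; apply: ae_integral_congr.
by apply: filterS fg => x /[apply] ->.
Qed.

End NullSet.

(** * Cells of an increasing sequence of endpoints *)

Section Cells.
Context (disp : Order.disp_t) (T : orderType disp) (n : nat).
Context (s : 'I_n.+1 -> T).
Local Open Scope order_scope.

(** The cell is the one that starts at the last endpoint below [x].  It is
used in the reals for the fan and in the extended reals for the reference. *)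
Lemma exists_cell (x : T) : (forall i, s i != x) -> s ord0 < x -> x < s ord_max ->
  exists i : 'I_n, (s (sector_lo i) < x) && (x < s (sector_hi i)).
Proof.
move=> sx s0 sn.
case: (@arg_maxnP _ ord0 (fun i => s i < x) (@nat_of_ord n.+1) s0) => k skx kmax.
have kn : (k < n)%N.
  rewrite ltn_neqAle -ltnS ltn_ord andbT; apply/eqP => kn.
  by move: sn; rewrite (_ : ord_max = k) ?ltNge ?(ltW skx)//; exact: val_inj.
exists (Ordinal kn); rewrite (_ : sector_lo _ = k); last exact: val_inj.
rewrite skx /= ltNge le_eqVlt negb_or sx /=; apply/negP => /kmax /=.
by rewrite /bump /= ltnn.
Qed.

Context (s_incr : forall i j : 'I_n.+1, (i < j)%N -> s i < s j).

Lemma endpoint_le (i j : 'I_n.+1) : (i <= j)%N -> s i <= s j.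
Proof.
rewrite leq_eqVlt => /predU1P[/val_inj -> //|/s_incr/ltW//].
Qed.

Lemma cell_uniq (x : T) (i j : 'I_n) :
  s (sector_lo i) < x -> x < s (sector_hi i) ->
  s (sector_lo j) < x -> x < s (sector_hi j) -> i = j.
Proof.
move=> ix xi jx xj; apply: val_inj; apply/eqP; rewrite eqn_leq; apply/andP.
by split; rewrite leqNgt; apply/negP => /(@endpoint_le (sector_hi _) (sector_lo _));
  rewrite leNgt => /negP; apply; [exact: lt_trans ix xj|exact: lt_trans jx xi].
Qed.
End Cells.

(** * Integrals of step functions on the strip *)

Lemma Rintegral_sum_indic d (T : measurableType d) (R : realType)
    (mu : {measure set T -> \bar R}) (I : finType) (D : set T)
    (c : I -> R) (B : I -> set T) :
  measurable D -> (forall i, measurable (B i)) ->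
  (forall i, (mu (B i `&` D) < +oo)%E) ->
  \int[mu]_(x in D) (\sum_i c i * \1_(B i) x) =
  \sum_i c i * fine (mu (B i `&` D)).
Proof.
move=> mD mB fB.
have intB i : mu.-integrable D (fun x => (\1_(B i) x)%:E).
  apply/integrableP; split; first exact/measurable_realfun.measurable_EFinP.
  under eq_integral do rewrite gee0_abs ?lee_fin//.
  by rewrite integral_indic.
rewrite /Rintegral.
under eq_integral do rewrite -sumEFin.
rewrite integral_sum//; last first.
  by move=> i; under eq_fun do rewrite EFinM; exact: integrableZl.
rewrite -[RHS]/(fine _%:E) -sumEFin; congr fine; apply: eq_bigr => i _.
under eq_integral do rewrite EFinM.
by rewrite integralZl// integral_indic// EFinM fineK// ge0_fin_numE.
Qed.

Section Plane.
Context {R : realType}.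

(* The product measure is recognized as a measure only under its unfolded
   name; this makes the lemmas on measures available for [leb2]. *)
HB.instance Definition _ := Measure.copy (@leb2 R)
  (@lebesgue_measure R \x @lebesgue_measure R)%E.

#[global] Instance ae_leb2_filter : Filter (nbhs (almost_everywhere (@leb2 R))).
Proof. exact: ae_filter_ringOfSetsType. Qed.

Lemma leb2_strip_itv (l a b : R) : 0 < l ->
  leb2 ([set x : plane R | a < x.2 < b] `&` strip l) =
  (l * Num.max 0 (b - a))%:E.
Proof.
move=> l0; rewrite (_ : _ `&` _ = `[0, l[%classic `*` `]a, b[%classic); last first.
  by apply/seteqP; split=> x /=; rewrite !in_itv/= => -[].
rewrite [LHS]product_measure1E//= !lebesgue_measure_itv /= !lte_fin l0 sube0.
case: ltP => ab; first by rewrite max_r ?subr_ge0 ?ltW// -EFinB -EFinM.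
by rewrite max_l ?subr_le0// mule0 mulr0.
Qed.

Lemma measurable_strip (l : R) : measurable (strip l).
Proof.
rewrite (_ : strip l = `[0, l[%classic `*` setT); last first.
  by apply/seteqP; split=> x /=; rewrite !in_itv/= => // -[].
exact: measurableX.
Qed.

Lemma measurable_snd_itv (a b : R) : measurable [set x : plane R | a < x.2 < b].
Proof.
rewrite (_ : [set x | _] = setT `*` `]a, b[%classic); last first.
  by apply/seteqP; split=> x /=; rewrite !in_itv/= => // -[].
exact: measurableX.
Qed.

Lemma ae_snd_neq (a : R) : {ae leb2, forall x : plane R, x.2 != a}.
Proof.
exists (setT `*` [set a]); split.
- exact: measurableX.
- by rewrite [LHS]product_measure1E//= lebesgue_measure_set1 mule0.
- by move=> x /= /negP; rewrite negbK => /eqP.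
Qed.

End Plane.

(** * The pointwise difference of two densities *)

Section Pointwise.
Context {R : realType} (p e : R -> R) (d : riemann_data R) (F : fan R)
  (G : reference R) (U V : flow R).
Context (hF : admissible_fan p e d F) (hG : ref_partition G)
  (hV : has_profile G V) (hFG : agree_outside_fan d F G).

Lemma in_sectorE (i : 'I_(fan_size F)) (z : spacetime R) : 0 < z.2 ->
  in_sector i z = (nu (sector_lo i) < z.1.2 / z.2) &&
                  (z.1.2 / z.2 < nu (sector_hi i)).
Proof. by move=> z0; rewrite /in_sector ltr_pdivlMr// ltr_pdivrMr. Qed.

Lemma in_sector_inj (i j : 'I_(fan_size F)) (z : spacetime R) : 0 < z.2 ->
  in_sector i z -> in_sector j z -> i = j.
Proof.
move=> z0; rewrite !in_sectorE// => /andP[i1 i2] /andP[j1 j2].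
exact: (cell_uniq (fan_nu_incr hF) i1 i2 j1 j2).
Qed.

Lemma in_left_sector (i : 'I_(fan_size F)) (z : spacetime R) : 0 < z.2 ->
  in_sector i z -> ~~ in_left F z.
Proof.
move=> z0 /andP[iz _]; rewrite /in_left -leNgt (le_trans _ (ltW iz))//.
by rewrite ler_pM2r//; apply: (endpoint_le (fan_nu_incr hF)).
Qed.

Lemma in_right_sector (i : 'I_(fan_size F)) (z : spacetime R) : 0 < z.2 ->
  in_sector i z -> ~~ in_right F z.
Proof.
move=> z0 /andP[_ iz]; rewrite /in_right -leNgt (le_trans (ltW iz))//.
rewrite ler_pM2r//; apply: (endpoint_le (fan_nu_incr hF)).
exact: (leq_ord (sector_hi i)).
Qed.

(** Away from the rays, a point lies in exactly one reference sector, and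
either in exactly one fan sector, where a single term of the sum survives, or
in one of the two outer regions, where the profiles agree and both sides
vanish. *)
Lemma density_difference (g : R -> R -> R) (z : spacetime R) : 0 < z.2 ->
  (forall i : 'I_(fan_size F).+1, z.1.2 != nu i * z.2) ->
  (forall j : 'I_(ref_size G).+1, sigma j != (z.1.2 / z.2)%:E) ->
  realizes_at d F U z ->
  g (rho U z) (normsq (vel U z)) - g (rho V z) (normsq (vel V z)) =
  \sum_(i < fan_size F) \sum_(j < ref_size G)
    (g (fan_rho i) (fan_C i) - g (ref_rho j) (ref_C j)) *
    (in_sector i z && in_ref_sector j z)%:R.
Proof.
move=> z0 nuz sz [rhoU Ul Ur Um].
case: hG => s0 sn sincr.
have [j jz] : exists j : 'I_(ref_size G), in_ref_sector j z.
  by apply: (@exists_cell _ _ _ (@sigma _ G)) => //; rewrite ?s0 ?sn ?ltNyr ?ltry.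
have [rhoV velV] := hV z0 jz.
have [agl agr] := hFG z0 jz.
(* No term survives in the outer regions. *)
have out : (forall i : 'I_(fan_size F), ~~ in_sector i z) ->
  \sum_(i < fan_size F) \sum_(j < ref_size G)
    (g (fan_rho i) (fan_C i) - g (ref_rho j) (ref_C j)) *
    (in_sector i z && in_ref_sector j z)%:R = 0.
  move=> oz; rewrite big1// => i _; rewrite big1// => j' _.
  by rewrite (negbTE (oz i)) mulr0.
rewrite rhoU rhoV velV.
have [zl|zl] := boolP (in_left F z).
  have [-> ->] := agl zl; rewrite (Ul zl) /rho_bar /fan_field zl out ?subrr//.
  by move=> i; apply: contraTN zl => /(in_left_sector z0).
have [zr|zr] := boolP (in_right F z).
  have [-> ->] := agr zr; rewrite (Ur zr) /rho_bar /fan_field (negbTE zl).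
  have nz (i : 'I_(fan_size F)) : ~~ in_sector i z.
    by apply: contraTN zr => /(in_right_sector z0).
  by case: pickP => [i|_]; [rewrite (negbTE (nz i))|rewrite out ?subrr].
have [i] : exists i : 'I_(fan_size F), (nu (sector_lo i) < z.1.2 / z.2) &&
                  (z.1.2 / z.2 < nu (sector_hi i)).
  apply: exists_cell.
  - by move=> i; apply: contra (nuz i) => /eqP ->; rewrite divfK// gt_eqF.
  - by rewrite ltr_pdivlMr// lt_neqAle eq_sym nuz leNgt.
  - by rewrite ltr_pdivrMr// lt_neqAle nuz leNgt.
rewrite -in_sectorE// => iz.
rewrite (Um _ iz) /rho_bar /fan_field (negbTE zl).
case: pickP => [i'|/(_ i)]; last by rewrite iz.
move=> /in_sector_inj -/(_ i z0 iz) ->.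
rewrite (bigD1 i)//= (bigD1 j)//= iz jz mulr1 !big1 ?addr0//.
- move=> i1 /negP i1i; rewrite big1// => j1 _.
  have [i1z|_] := boolP (in_sector i1 z); last by rewrite mulr0.
  by case: i1i; apply/eqP; exact: in_sector_inj iz.
- move=> j1 /negP j1j; have [j1z|_] := boolP (in_ref_sector j1 z); last by rewrite mulr0.
  case: j1j; apply/eqP; case/andP: jz => a1 a2; case/andP: j1z => b1 b2.
  exact: (cell_uniq sincr b1 b2 a1 a2).
Qed.

End Pointwise.

(** * Integrals over time slices *)

Section Slice.
Context {R : realType}.

Definition overlap_lo (F : fan R) (G : reference R) (i : 'I_(fan_size F))
    (j : 'I_(ref_size G)) : R :=
  fine (maxe (nu (sector_lo i))%:E (sigma (sector_lo j))).

Definition overlap_hi (F : fan R) (G : reference R) (i : 'I_(fan_size F))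
    (j : 'I_(ref_size G)) : R :=
  fine (mine (nu (sector_hi i))%:E (sigma (sector_hi j))).

(** Strict monotonicity of the reference speeds makes both endpoints finite:
a left endpoint is never [+oo] and a right one never [-oo], although the
outermost speeds are infinite. *)
Lemma in_overlapE (F : fan R) (G : reference R) (i : 'I_(fan_size F))
    (j : 'I_(ref_size G)) (z : spacetime R) : ref_partition G -> 0 < z.2 ->
  in_sector i z && in_ref_sector j z =
  (overlap_lo i j * z.2 < z.1.2 < overlap_hi i j * z.2).
Proof.
case=> _ _ sincr z0.
have sj : (sigma (sector_lo j) < sigma (sector_hi j))%E by exact: sincr.
rewrite in_sectorE// /in_ref_sector -(ltr_pdivlMr _ _ z0) -(ltr_pdivrMr _ _ z0).
rewrite -[in RHS]lte_fin -[(_ / _ < overlap_hi i j)]lte_fin !fineK.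
- by rewrite gt_max lt_min !lte_fin andbACA.
- by rewrite fin_numElt lt_min gt_min ltNyr ltry (le_lt_trans (leNye _) sj).
- by rewrite fin_numElt lt_max gt_max ltNyr ltry (lt_le_trans sj (leey _)).
Qed.

Context (p e : R -> R) (d : riemann_data R) (F : fan R) (G : reference R)
  (U V : flow R).
Context (hF : admissible_fan p e d F) (hUt : realizes_timewise d F U)
  (hU0 : starts_from d U) (hG : ref_partition G) (hV : has_profile G V)
  (hV0 : starts_from d V) (hFG : agree_outside_fan d F G).

(** Self-similarity: the cell of slopes between [a] and [b] meets the strip at
time [t] in a rectangle of sides [l] and [(b - a) * t]. *)
Lemma slice_integral (g : R -> R -> R) (l t : R) : 0 < l -> 0 <= t ->
  \int[leb2]_(x in strip l)
    (g (rho U (x, t)) (normsq (vel U (x, t))) -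
     g (rho V (x, t)) (normsq (vel V (x, t)))) =
  l * t * \sum_(i < fan_size F) \sum_(j < ref_size G)
    overlap i j * (g (fan_rho i) (fan_C i) - g (ref_rho j) (ref_C j)).
Proof.
move=> l0; rewrite le_eqVlt => /predU1P[<-|t0].
  rewrite mulr0 mul0r (@ae_Rintegral_congr _ _ _ leb2 _ _ (cst 0)).
    by rewrite Rintegral_cst ?mul0r//; exact: measurable_strip.
  by apply: filterS2 hU0 hV0 => x [-> ->] [-> ->] _; rewrite subrr.
pose c (k : 'I_(fan_size F) * 'I_(ref_size G)) : R :=
  g (fan_rho k.1) (fan_C k.1) - g (ref_rho k.2) (ref_C k.2).
pose B (k : 'I_(fan_size F) * 'I_(ref_size G)) : set (plane R) :=
  [set x | overlap_lo k.1 k.2 * t < x.2 < overlap_hi k.1 k.2 * t].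
have muB k : leb2 (B k `&` strip l) =
    (l * Num.max 0 (overlap_hi k.1 k.2 * t - overlap_lo k.1 k.2 * t))%:E.
  exact: leb2_strip_itv.
rewrite (@ae_Rintegral_congr _ _ _ leb2 _ _ (fun x => \sum_k c k * \1_(B k) x)).
  rewrite Rintegral_sum_indic.
  - rewrite pair_bigA mulr_sumr; apply: eq_bigr => -[i j] _ /=.
    rewrite muB/= -mulrBl.
    rewrite -[X in Num.max X](mul0r t) -maxr_pMl ?ltW// /overlap.
    by rewrite -/(overlap_lo i j) -/(overlap_hi i j) /c /=; ring.
  - exact: measurable_strip.
  - by move=> k; exact: measurable_snd_itv.
  - by move=> k; rewrite [X in (X < _)%E]muB ltry.
(* The rays, where neither profile is prescribed, form a null set. *)
have nunz : {ae leb2, forall x : plane R, forall i : 'I_(fan_size F).+1,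
    x.2 != nu i * t}.
  by apply: filter_forall => i; exact: ae_snd_neq.
have snz : {ae leb2, forall x : plane R, forall j : 'I_(ref_size G).+1,
    x.2 != fine (sigma j) * t}.
  by apply: filter_forall => j; exact: ae_snd_neq.
apply: filterS3 nunz snz (hUt t0) => x nux sx Ux _.
rewrite (density_difference hF hG hV hFG g _ _ _ Ux)//=.
  rewrite pair_bigA; apply: eq_bigr => -[i j] _ /=.
  rewrite in_overlapE//= indicE; congr (_ * _%:R).
  by congr nat_of_bool; apply/idP/idP => [/mem_set//|/set_mem].
move=> j; apply: contra (sx j) => /eqP ->.
by rewrite /= divfK// gt_eqF.
Qed.

(** Deduced by changing the sign of [g], since the linearity of the integral
is not available for integrands that may fail to be measurable. *)
Lemma slice_integral_swap (g : R -> R -> R) (l t : R) : 0 < l -> 0 <= t ->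
  \int[leb2]_(x in strip l)
    (g (rho V (x, t)) (normsq (vel V (x, t))) -
     g (rho U (x, t)) (normsq (vel U (x, t)))) =
  - (l * t * \sum_(i < fan_size F) \sum_(j < ref_size G)
    overlap i j * (g (fan_rho i) (fan_C i) - g (ref_rho j) (ref_C j))).
Proof.
move=> l0 t0.
under eq_Rintegral do rewrite -opprB opprD.
rewrite (slice_integral (fun r c => - g r c))// -mulrN -sumrN; congr (_ * _).
by apply: eq_bigr => i _; rewrite -sumrN; apply: eq_bigr => j _; rewrite -opprD mulrN.
Qed.

Lemma sum_overlap_energy :
  \sum_(i < fan_size F) \sum_(j < ref_size G)
    overlap i j * ((fan_rho i * fan_C i / 2 + fan_rho i * e (fan_rho i)) -
                   (ref_rho j * ref_C j / 2 + ref_rho j * e (ref_rho j))) =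
  internal_mismatch e F G - kinetic_mismatch F G / 2.
Proof.
rewrite /internal_mismatch /kinetic_mismatch mulr_suml -sumrB.
apply: eq_bigr => i _; rewrite mulr_suml -sumrB; apply: eq_bigr => j _.
by field.
Qed.

Lemma sum_overlap_lagrangian :
  \sum_(i < fan_size F) \sum_(j < ref_size G)
    overlap i j * ((fan_rho i * fan_C i / 2 - fan_rho i * e (fan_rho i)) -
                   (ref_rho j * ref_C j / 2 - ref_rho j * e (ref_rho j))) =
  - (internal_mismatch e F G + kinetic_mismatch F G / 2).
Proof.
rewrite /internal_mismatch /kinetic_mismatch mulr_suml -big_split -sumrN.
apply: eq_bigr => i _; rewrite mulr_suml -big_split -sumrN; apply: eq_bigr => j _.
by rewrite /=; field.
Qed.

End Slice.

(** * The two criteria for explicit gaps *)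

Section Criteria.
Context {R : realType}.

Lemma Rintegral_linear (c t : R) : 0 < t ->
  \int[@lebesgue_measure R]_(s in `[0, t]) (c * s) = c * t ^+ 2 / 2.
Proof.
move=> t0; rewrite /Rintegral.
rewrite (@continuous_FTC2 _ _ (fun s => c / 2 * s ^+ 2))//.
- by rewrite /=; field.
- by apply: continuous_subspaceT => x; apply: cvgM; [exact: cvg_cst|exact: cvg_id].
- split.
  + by move=> x _; exact: derivableM.
  + apply: cvg_at_right_filter; apply: cvgM; first exact: cvg_cst.
    exact: exprn_continuous.
  + apply: cvg_at_left_filter; apply: cvgM; first exact: cvg_cst.
    exact: exprn_continuous.
- move=> x _; rewrite derive1E deriveM// derive_cst scaler0 addr0.
  by rewrite exp_derive /= /GRing.scale /=; field.
Qed.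

Lemma entropy_rate_prefers_linear (e : R -> R) (l t c : R) (U1 U2 : flow R) :
  0 <= t -> (forall s, 0 <= s -> Delta_E e l U1 U2 s = c * s) ->
  entropy_rate_prefers e l t U1 U2 <-> c < 0.
Proof.
move=> t0 dE.
have lim : h^-1 * (Delta_E e l U1 U2 (t + h) - Delta_E e l U1 U2 t) @[h --> 0^'+]
    --> c.
  apply: cvg_near_cst; near=> h.
  have h0 : 0 < h by near: h; exact: nbhs_right_gt.
  rewrite !dE ?addr_ge0 ?(ltW h0)// -mulrBr [t + h]addrC addrK.
  by rewrite mulrCA mulVf ?mulr1// gt_eqF.
split=> [[c' lim' c'0]|c0]; last by exists c.
by rewrite (cvg_unique _ lim lim').
Unshelve. all: by end_near. Qed.

Lemma action_rate_prefers_quadratic (e : R -> R) (l c : R) (U1 U2 : flow R) :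
  (forall s, 0 <= s -> \int[leb2]_(x in strip l)
    (lagrangian e (rho U1 (x, s)) (vel U1 (x, s)) -
     lagrangian e (rho U2 (x, s)) (vel U2 (x, s))) = c * s) ->
  action_rate_prefers e l U1 U2 <-> c < 0.
Proof.
move=> dL.
have dA t : 0 < t -> Delta_A e l U1 U2 t = c * t ^+ 2 / 2.
  move=> t0; rewrite -Rintegral_linear//; apply: eq_Rintegral => s.
  by rewrite inE/= in_itv/= => /andP[s0 _]; rewrite dL.
split=> [[t1 t10 [_ [t /andP[t0 _]]]]|c0].
  by rewrite dA// pmulr_llt0 ?invr_gt0// pmulr_llt0// exprn_gt0.
have neg t : 0 < t -> Delta_A e l U1 U2 t < 0.
  by move=> t0; rewrite dA// pmulr_llt0 ?invr_gt0// pmulr_llt0// exprn_gt0.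
exists 1 => //; split=> [t /andP[t0 _]|]; first exact/ltW/neg.
exists 2^-1; last by apply: neg; rewrite invr_gt0.
by rewrite invr_gt0 ltr0n/= invf_lt1 ?ltr1n.
Qed.

End Criteria.

(** * The comparison *)

Theorem corollary4p2 (R : realType) (p e : R -> R) (d : riemann_data R)
    (F : fan R) (G : reference R) (U V : flow R) (l t : R)
    (hp : pressure_law p e)
    (hF : admissible_fan p e d F)
    (hU : realization p e d F U)
    (hUt : realizes_timewise d F U)
    (hU0 : starts_from d U)
    (hV : reference_solution p d G V)
    (hV0 : starts_from d V)
    (hFG : agree_outside_fan d F G)
    (hl : 0 < l) (ht : 0 <= t) :
  let K := kinetic_mismatch F G in
  let I := internal_mismatch e F G in
  [/\ (action_rate_prefers e l U V /\ entropy_rate_prefers e l t U V) <->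
        (0 < K /\ `|I| < K / 2),
      (action_rate_prefers e l V U /\ entropy_rate_prefers e l t V U) <->
        (K < 0 /\ `|I| < `|K| / 2),
      (action_rate_prefers e l U V /\ entropy_rate_prefers e l t V U) <->
        `|K| / 2 < I &
      (action_rate_prefers e l V U /\ entropy_rate_prefers e l t U V) <->
        I < - (`|K| / 2)].
Proof.
move=> K I; have [hG hpr _] := hV.
pose H r c := r * c / 2 + r * e r.
pose L r c := r * c / 2 - r * e r.
have int s g := slice_integral hF hUt hU0 hG hpr hV0 hFG g (t := s) hl.
have intN s g := slice_integral_swap hF hUt hU0 hG hpr hV0 hFG g (t := s) hl.
have eUV : entropy_rate_prefers e l t U V <-> I < K / 2.
  rewrite (@entropy_rate_prefers_linear _ _ _ _ (l * (I - K / 2)))//.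
    by rewrite pmulr_rlt0// subr_lt0.
  by move=> s s0; rewrite [LHS](int _ H)// sum_overlap_energy mulrAC.
have eVU : entropy_rate_prefers e l t V U <-> K / 2 < I.
  rewrite (@entropy_rate_prefers_linear _ _ _ _ (l * (K / 2 - I)))//.
    by rewrite pmulr_rlt0// subr_lt0.
  by move=> s s0; rewrite [LHS](intN _ H)// sum_overlap_energy -mulrN opprB mulrAC.
have aUV : action_rate_prefers e l U V <-> - (K / 2) < I.
  rewrite (@action_rate_prefers_quadratic _ _ _ (l * - (I + K / 2))).
    by rewrite pmulr_rlt0// oppr_lt0 -ltrBlDr sub0r.
  by move=> s s0; rewrite [LHS](int _ L)// sum_overlap_lagrangian mulrAC.
have aVU : action_rate_prefers e l V U <-> I < - (K / 2).
  rewrite (@action_rate_prefers_quadratic _ _ _ (l * (I + K / 2))).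
    by rewrite pmulr_rlt0// -[X in _ <-> _ < X]sub0r ltrBrDr.
  by move=> s s0; rewrite [LHS](intN _ L)// sum_overlap_lagrangian -mulrN opprK mulrAC.
(* What remains is linear arithmetic in [K] and [I], split on the sign of [K]. *)
split; rewrite ?eUV ?eVU ?aUV ?aVU; clearbody K I;
  have [K0|K0] := ger0P K; rewrite ?ltr_norml.
all: split=> [[? ?]|]; try (by move=> ?; split; lra); try lra.
all: try by move=> [? /andP[? ?]]; split; lra.
all: by split; [|apply/andP; split]; lra.
Qed.
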